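(* Let $d\ge2$ and let $i,j$ be nonnegative integers with $j<d-1$ such that either $(i,j)=(0,0)$, or $i\ge1$ and $i+j\le d-1$. Define $$f_d(i,j,x)=\sum_{k=0}^{d-1} C_{d-1-k}(1-x)^kx^{d-k}\sum_{s=0}^{j}\binom{j}{s}\binom{d+i+j-1-k-s}{k-s},\qquad C_n=\tfrac1{n+1}\tbinom{2n}{n}.$$ Then for every $m$, the coefficient of $x^{d-m}$ in $f_d(i,j,x)$ equals the number of plane trees on $d$ vertices (with vertices labeled $1,\ldots,d$ in postorder) having exactly $m$ vertices $v$ with one of the following properties: $v$ is a type $(0)$ special vertex; $v$ is a type $(1)$ special vertex whose postorder label is at most $i$ or at least $d-j$; $v$ is a type $(2)$ special vertex whose postorder label is at least $d-j$.
   Context: A plane tree is a rooted tree in which the children of each vertex are linearly ordered (left to right); the first child in this order is the leftmost child. A leaf is a vertex with no children. Postorder labeling of a plane tree on $n$ vertices: remove the root, label the vertices of the subtrees rooted at the root's children, taken left to right, consecutively, each subtree recursively in postorder; finally give the root label $n$. Special vertices: $v$ is type $(0)$ if $v$ is a leaf, is the leftmost child of its parent, and its parent is not the root; $v$ is type $(1)$ if $v$ is a leaf and either $v$ is the leftmost child of the root or $v$ is not the leftmost child of its parent; $v$ is type $(2)$ if $v$ is not a leaf and is the leftmost child of its parent. (The polynomial $f_d(i,j,x)$ is the change in Stanley's toric $f$-polynomial of the face poset caused by adding a facet of type $(i,j)$ in a shelling of a $(d-1)$-dimensional cubical complex; the hypotheses on $(i,j)$ describe the possible types with $j<d-1$.)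 *)

(* Defs.v *)
From HB Require Import structures.
From mathcomp Require Import all_boot all_order all_algebra.

Set Implicit Arguments.
Unset Strict Implicit.
Unset Printing Implicit Defensive.

Import GRing.Theory.

(* A plane tree is its root together with the left-to-right sequence of the
   subtrees rooted at the children of the root. *)
Inductive ptree := Node of seq ptree.

Definition children (t : ptree) : seq ptree := let: Node ts := t in ts.

Fixpoint nvertices (t : ptree) : nat :=
  let: Node ts := t in (sumn [seq nvertices u | u <- ts]).+1.

(* A vertex is represented by its address, the sequence of child positions
   (counted from 0) on the path leading to it from the root; the root is
   [::]. *)
Definition vertex := seq nat.

Fixpoint postorder (t : ptree) : seq vertex :=
  let: Node ts := t in
  let ps := [seq postorder u | u <- ts] in
  rcons (flatten (mkseq (fun k => [seq k :: v | v <- nth [::] ps k]) (size ps)))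
        [::].

Definition label (t : ptree) (v : vertex) : nat := (index v (postorder t)).+1.

Definition subtree (t : ptree) (v : vertex) : ptree :=
  foldl (fun u k => nth (Node [::]) (children u) k) t v.

Definition leaf (t : ptree) (v : vertex) : bool :=
  nilp (children (subtree t v)).

Definition leftmost (v : vertex) : bool := (v != [::]) && (last 0 v == 0).

Definition parent (v : vertex) : vertex := take (size v).-1 v.

Definition is_root (v : vertex) : bool := nilp v.

Definition special0 (t : ptree) (v : vertex) : bool :=
  [&& leaf t v, leftmost v & ~~ is_root (parent v)].

(* The root is never special of type (1) in a tree with at least two vertices,
   since it is not a leaf. *)
Definition special1 (t : ptree) (v : vertex) : bool :=
  leaf t v && ((leftmost v && is_root (parent v)) || ~~ leftmost v).

Definition special2 (t : ptree) (v : vertex) : bool :=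
  ~~ leaf t v && leftmost v.

Definition counted (d i j : nat) (t : ptree) (v : vertex) : bool :=
  [|| special0 t v,
      special1 t v && ((label t v <= i) || (d - j <= label t v)) |
      special2 t v && (d - j <= label t v)].

Definition ncounted (d i j : nat) (t : ptree) : nat :=
  count (counted d i j t) (postorder t).

Lemma ptree_ind' (P : ptree -> Prop) :
  (forall ts, foldr (fun t => and (P t)) True ts -> P (Node ts)) ->
  forall t, P t.
Proof.
move=> H; fix IH 1; case=> ts; apply: H.
by elim: ts => [//|t ts IHts]; split; [apply: IH | apply: IHts].
Qed.

Lemma size_postorder t : size (postorder t) = nvertices t.
Proof.
elim/ptree_ind': t => ts IH /=.
rewrite size_rcons size_flatten /shape -map_comp; congr (sumn _).+1.
rewrite (eq_map (g := fun k => size (nth [::] [seq postorder u | u <- ts] k)));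
  last by move=> k /=; rewrite size_map.
rewrite (map_comp size (nth [::] _)) map_nth_iota0 // take_size -map_comp.
by elim: ts IH => [//|t ts IHts] /= [-> /IHts ->].
Qed.

Lemma postorder_uniq t : uniq (postorder t).
Proof.
elim/ptree_ind': t => ts IH /=; rewrite rcons_uniq; apply/andP; split.
  by apply/flattenP => -[s /mapP[k _ ->] /mapP[v]].
rewrite size_map.
have Hu k : uniq (nth [::] [seq postorder u | u <- ts] k).
  elim: ts IH k => [_ k|t ts IHts [Ht Hts] [|k]] //=; first by rewrite nth_nil.
  exact: IHts.
have := iota_uniq 0 (size ts); rewrite /mkseq.
elim: (iota 0 _) => [//|k ks IHks] /= /andP[kks uks].
rewrite cat_uniq IHks // andbT map_inj_uniq ?Hu //=; last by move=> ? ? [].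
apply/hasPn => w /flattenP[s /mapP[l lks ->] /mapP[v _ ->]].
by apply/mapP => -[v' _ [lk _]]; rewrite -lk lks in kks.
Qed.

(* Plane trees on d vertices form a finite type: a tree with d vertices is
   encoded by a word of d balanced pairs of parentheses. *)

Fixpoint dyck (t : ptree) : seq bool :=
  let: Node ts := t in true :: rcons (flatten [seq dyck u | u <- ts]) false.

(* The stack holds the sequences of trees of the currently open vertices. *)
Fixpoint undyck_rec (st : seq (seq ptree)) (w : seq bool) : option ptree :=
  match w, st with
  | [::], [:: [:: t]] => Some t
  | true :: w', _ => undyck_rec ([::] :: st) w'
  | false :: w', ts :: us :: st' => undyck_rec (rcons us (Node ts) :: st') w'
  | _, _ => None
  end.

Definition undyck := undyck_rec [:: [::]].

Lemma undyck_rec_dyck t us st w :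
  undyck_rec (us :: st) (dyck t ++ w) = undyck_rec (rcons us t :: st) w.
Proof.
elim/ptree_ind': t us st w => ts IH us st w /=.
have: undyck_rec ([::] :: us :: st) (flatten [seq dyck u | u <- ts] ++ false :: w)
      = undyck_rec (([::] ++ ts) :: us :: st) (false :: w).
  elim: ts IH [::] => [_ ts0|t ts IHts [Ht Hts] ts0]; first by rewrite cats0.
  by rewrite /= -catA Ht IHts // cat_rcons.
by rewrite cat_rcons => ->.
Qed.

Lemma dyckK : pcancel dyck undyck.
Proof. by move=> t; rewrite -[dyck t]cats0 /undyck undyck_rec_dyck. Qed.

HB.instance Definition _ := Countable.copy ptree (pcan_type dyckK).

Lemma size_dyck t : size (dyck t) = (nvertices t).*2.
Proof.
elim/ptree_ind': t => ts IH /=; rewrite size_rcons size_flatten /shape -map_comp.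
rewrite doubleS; congr _.+2.
by elim: ts IH => [//|t ts IHts] /= [-> /IHts ->]; rewrite doubleD.
Qed.

Record plane_tree (d : nat) :=
  PlaneTree { pt_val :> ptree; pt_valP : nvertices pt_val == d }.

HB.instance Definition _ d := [isSub for @pt_val d].
HB.instance Definition _ d := [Countable of plane_tree d by <:].

Definition pt_dyck d (T : plane_tree d) : (d.*2).-tuple bool :=
  insubd [tuple of nseq d.*2 false] (dyck T).

Definition pt_undyck d (w : (d.*2).-tuple bool) : option (plane_tree d) :=
  obind insub (undyck w).

Lemma pt_dyckK d : pcancel (@pt_dyck d) (@pt_undyck d).
Proof.
move=> T; rewrite /pt_undyck /pt_dyck val_insubd size_dyck (eqP (pt_valP T)) eqxx.
by rewrite dyckK /= valK.
Qed.

HB.instance Definition _ d : isFinite (plane_tree d) :=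
  PCanIsFinite (@pt_dyckK d).

Definition catalan (n : nat) : nat := 'C(n.*2, n) %/ n.+1.

Lemma catalanE n : catalan n * n.+1 = 'C(n.*2, n).
Proof.
have E : n.+1 * 'C(n.*2, n.+1) = n * 'C(n.*2, n).
  by rewrite mul_bin_left -addnn addnK.
apply/divnK/dvdnP; exists ('C(n.*2, n) - 'C(n.*2, n.+1)).
by rewrite mulnBl [X in _ - X]mulnC E mulnS [n * _]mulnC addnK.
Qed.

Local Open Scope ring_scope.

(* In the range of summation d + i + j - 1 - k - s is nonnegative.  The
   condition s <= k discards the terms whose binomial coefficient has the
   negative lower index k - s, which truncated subtraction would send to 0. *)
Definition fpoly (d i j : nat) : {poly int} :=
  \sum_(0 <= k < d)
    (catalan (d - 1 - k))%:R * (1 - 'X) ^+ k * 'X^(d - k) *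
    (\sum_(0 <= s < j.+1 | (s <= k)%N)
       'C(j, s) * 'C(d + i + j - 1 - k - s, k - s))%N%:R.

(* The exponent d - m is negative for m > d; the coefficient is then 0. *)
Definition coefz (p : {poly int}) (e : int) : int :=
  if e is Posz n then p`_n else 0.

(* Main.v *)
(* Without its root, a plane tree on d vertices is a forest, and a forest is a
   binary tree with d - 1 nodes: the left subtree of a node holds its preceding
   siblings and the right subtree its children.  Postorder is preserved, a leaf
   is a node without right child and a leftmost child a node without left child.
   So type (0) is a node without children, type (1) a node with a left child
   only, type (2) a node with a right child only (except for the vertex
   of label 1 when it is a child of the root).

   Replacing a node with one child by this child is a bijection onto all smaller
   trees that keeps postorder.  Hence, when i >= 1, counting also the label i + 1
   adds (1 - x) times the polynomial of d - 1 vertices to the tree polynomial,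
   and increasing j adds it twice, once for each type.  By Pascal's rule the sum
   defining f_d(i, j, x) satisfies the same recurrences.  For (i, j) = (1, 0) only the binary leaves
   count, and removing k marked leaves from a tree with n nodes leaves a tree with
   n - k nodes and k of its n - k + 1 empty slots, which gives
   C_{n-k} 'C(n - k + 1, k).  The case (0, 0) is reduced to (1, 0) by deleting the
   first child of the root when it is a leaf. *)
Require Import Defs.
From mathcomp Require Import all_boot all_order all_algebra.
From mathcomp Require Import zify ring.

Set Implicit Arguments.
Unset Strict Implicit.
Unset Printing Implicit Defensive.

Import GRing.Theory.
Local Open Scope ring_scope.

(** * Splitting off the last child of the root *)

(* [t] and the children of [u] are the left and right subtrees of the last
   non-root vertex in postorder. *)
Definition graft (t u : ptree) : ptree := Node (rcons (children t) u).

Definition descendants (t : ptree) : seq vertex :=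
  flatten (mkseq (fun k => [seq k :: v | v <- postorder (nth (Node [::]) (children t) k)])
    (size (children t))).

Lemma postorderE t : postorder t = rcons (descendants t) [::].
Proof.
case: t => ts /=; rewrite /descendants size_map /=; congr (rcons (flatten _) _).
apply/eq_in_map => k; rewrite mem_iota => /andP[_ lt_k].
by rewrite (nth_map (Node [::])).
Qed.

Lemma size_descendants t : size (descendants t) = (nvertices t).-1.
Proof. by rewrite -size_postorder postorderE size_rcons. Qed.

Lemma nvertices_gt0 t : (0 < nvertices t)%N.
Proof. by case: t. Qed.

Lemma nvertices_graft t u :
  nvertices (graft t u) = (nvertices t + nvertices u)%N.
Proof. by case: t => ts /=; rewrite map_rcons sumn_rcons addSn. Qed.

Lemma descendants_graft t u :
  descendants (graft t u) =
  descendants t ++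
  rcons [seq size (children t) :: v | v <- descendants u] [:: size (children t)].
Proof.
case: t => ts; rewrite /descendants /= size_rcons /mkseq.
rewrite -[(size ts).+1]addn1 iotaD map_cat flatten_cat.
congr (flatten _ ++ _); last first.
  by rewrite /= add0n cats0 nth_rcons ltnn eqxx postorderE map_rcons.
apply/eq_in_map => k; rewrite mem_iota => /andP[_ lt_k].
by rewrite nth_rcons lt_k.
Qed.

Lemma descendants_neq_root t v : v \in descendants t -> v != [::].
Proof. by case/flattenP => s /mapP[k _ ->] /mapP[w _ ->]. Qed.

Lemma descendants_head t v :
  v \in descendants t -> (head 0 v < size (children t))%N.
Proof.
case/flattenP => s /mapP[k]; rewrite mem_iota => /andP[_ lt_k] -> /mapP[w _ ->].
by [].
Qed.

Lemma graft_inj t u t' u' : graft t u = graft t' u' -> t = t' /\ u = u'.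
Proof. by case: t t' => [ts] [ts'] [] /rcons_inj[-> ->]. Qed.

(** * Weighted sums over plane trees *)

Section TreeSums.
Variable R : comNzRingType.
Implicit Types (w : nat -> bool -> bool -> bool -> R) (t u : ptree).

Definition weight w t : R :=
  \prod_(p < size (descendants t))
    (let v := nth [::] (descendants t) p in
     w p (leaf t v) (leftmost v) (is_root (parent v))).

(* The weight seen by a subtree preceded by [k] vertices, none of whose
   non-root vertices is a child of the whole tree's root. *)
Definition inner (k : nat) w : nat -> bool -> bool -> bool -> R :=
  fun p l m _ => w (k + p)%N l m false.

(** The root of [u] becomes the last non-root vertex: a leaf iff [u] is a single vertex, leftmost
    iff [t] is. *)
Lemma weight_graft w t u :
  weight w (graft t u) =
  weight w t * weight (inner (nvertices t).-1 w) u *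
  w (nvertices t + nvertices u).-2%N (nvertices u == 1)%N (nvertices t == 1)%N true.
Proof.
rewrite /weight.
have -> : size (descendants (graft t u)) =
    (size (descendants t) + (size (descendants u)).+1)%N.
  by rewrite descendants_graft size_cat size_rcons size_map.
rewrite big_split_ord big_ord_recr /= mulrA; congr (_ * _ * _).
- apply: eq_bigr => p _; rewrite descendants_graft nth_cat ltn_ord.
  set v := nth _ _ _; have vt : v \in descendants t by rewrite mem_nth.
  have := descendants_neq_root vt; have := descendants_head vt.
  case: v {vt} => // k v /= lt_k _; congr w.
  by rewrite /leaf /subtree /= nth_rcons lt_k.
- apply: eq_bigr => p _; rewrite descendants_graft nth_cat ltnNge leq_addr /=.
  rewrite addKn nth_rcons size_map ltn_ord (nth_map [::]) //.
  set v := nth _ _ _; have vu : v \in descendants u by rewrite mem_nth.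
  have := descendants_neq_root vu; case: v {vu} => // k v _.
  rewrite /inner size_descendants; congr w.
  by rewrite /leaf /subtree /= nth_rcons ltnn eqxx.
- rewrite descendants_graft nth_cat ltnNge leq_addr /=.
  rewrite addKn nth_rcons size_map ltnn eqxx !size_descendants.
  have := nvertices_gt0 t; have := nvertices_gt0 u => u_gt0 t_gt0.
  congr w; first by lia.
  + rewrite /leaf /subtree /= nth_rcons ltnn eqxx.
    by case: u {u_gt0} => -[|[us] ts].
  + by rewrite /leftmost /=; case: t {t_gt0} => -[|[us] ts].
Qed.

Definition ptrees n : seq ptree := [seq pt_val T | T <- enum {: plane_tree n}].

Lemma mem_ptrees n t : (t \in ptrees n) = (nvertices t == n).
Proof.
apply/mapP/idP => [[T _ ->]|tn]; first exact: pt_valP.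
by exists (PlaneTree tn); rewrite ?mem_enum.
Qed.

Lemma ptrees_uniq n : uniq (ptrees n).
Proof. by rewrite map_inj_uniq ?enum_uniq //; exact: val_inj. Qed.

Lemma sum_ptrees n (F : ptree -> R) :
  \sum_(T : plane_tree n) F T = \sum_(t <- ptrees n) F t.
Proof. by rewrite big_map big_enum. Qed.

Lemma ptrees_graft n :
  perm_eq (ptrees n.+2)
    [seq graft x.1 x.2 | a <- iota 0 n.+1,
       x <- [seq (t, u) | t <- ptrees a.+1, u <- ptrees (n - a).+1]].
Proof.
apply: uniq_perm; first exact: ptrees_uniq.
  apply: allpairs_uniq_dep => [|a _|]; first exact: iota_uniq.
    by apply: allpairs_uniq; rewrite ?ptrees_uniq // => -[? ?] [? ?].
  (* The size of the left factor determines [a], so the blocks are disjoint. *)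
  have inD z : z \in [seq existT (fun=> ptree * ptree)%type a x | a <- iota 0 n.+1,
      x <- [seq (t, u) | t <- ptrees a.+1, u <- ptrees (n - a).+1]] ->
      nvertices (tagged z).1 = (tag z).+1.
    case/allpairsPdep => a [x [_ xa ->]]; move: xa => /=.
    by case/allpairsP => -[t u] [/= + _ ->]; rewrite mem_ptrees => /eqP.
  move=> [a [t u]] [b [t' u']] /inD/= ta /inD/= tb /graft_inj[tt ->].
  by move: ta; rewrite tt tb => -[->].
move=> t; rewrite mem_ptrees; apply/eqP/allpairsPdep => [tn|].
  case: t tn => ts; case/lastP: ts => // ts u tn.
  have := nvertices_graft (Node ts) u; rewrite {1}/graft /= in tn *; rewrite tn => tn'.
  have := nvertices_gt0 u => u_gt0.
  exists (nvertices (Node ts)).-1, (Node ts, u); split => //.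
    by rewrite -[_ :: _]/(iota 0 n.+1) mem_iota /=; move: tn'; lia.
  apply/allpairsP; exists (Node ts, u); split => //=; rewrite mem_ptrees //=.
  by apply/eqP; move: tn' => /=; lia.
case=> a [[t1 u1] [+ /allpairsP[[t2 u2] [/= + + [-> ->]]] ->]].
rewrite mem_iota !mem_ptrees nvertices_graft => /= an /eqP-> /eqP->; lia.
Qed.

Definition forest_sum n w : R := \sum_(T : plane_tree n.+1) weight w T.

Lemma forest_sum0 w : forest_sum 0 w = 1.
Proof.
rewrite /forest_sum sum_ptrees (perm_big [:: Node [::]]).
  by rewrite big_seq1 /weight big_ord0.
apply: uniq_perm => //; first exact: ptrees_uniq.
move=> [[|u us]]; rewrite mem_ptrees inE //=.
have := nvertices_gt0 u; rewrite [RHS](_ : _ = false); first by case: nvertices.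
by apply/eqP => -[].
Qed.

Lemma forest_sumS n w :
  forest_sum n.+1 w =
  \sum_(a < n.+1) forest_sum a w * forest_sum (n - a) (inner a w)
                  * w n (a == n :> nat) (a == 0 :> nat) true.
Proof.
rewrite /forest_sum sum_ptrees (perm_big _ (ptrees_graft n)) big_allpairs_dep.
rewrite -[iota 0 n.+1]/(index_iota 0 n.+1) big_mkord; apply: eq_bigr => a _.
rewrite big_allpairs /= !sum_ptrees big_distrlr mulr_suml /=.
rewrite big_seq [RHS]big_seq; apply: eq_bigr => t; rewrite mem_ptrees => /eqP ta.
rewrite mulr_suml big_seq [RHS]big_seq.
apply: eq_bigr => u; rewrite mem_ptrees => /eqP ua.
rewrite weight_graft ta ua /=; congr (_ * w _ _ _ _); have := ltn_ord a; lia.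
Qed.

(** Statuses that no tree realizes are ignored: the first vertex is a leftmost leaf, and a leftmost
    leaf attached to the root is the first vertex. *)
Lemma forest_sum_congr n w w' :
  (forall p l m r, (p < n)%N -> (p = 0 -> l && m)%N -> (l && m && r -> p = 0)%N ->
     w p l m r = w' p l m r) ->
  forest_sum n w = forest_sum n w'.
Proof.
elim/ltn_ind: n w w' => -[|n] IH w w' eq_w; first by rewrite !forest_sum0.
rewrite !forest_sumS; apply: eq_bigr => a _; have a_le : (a <= n)%N by rewrite -ltnS.
congr (_ * _ * _).
- by apply: IH => // p l m r p_lt; apply: eq_w; apply: leq_trans p_lt _; apply: ltnW.
- apply: IH => [|p l m r p_lt p0 _]; first by rewrite ltnS leq_subr.
  apply: eq_w => //; first by lia.
    by move=> ap0; apply: p0; lia.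
  by rewrite andbF.
- apply: eq_w => //; first by move=> n0; move: a_le; case: (nat_of_ord a); lia.
  by rewrite andbT => /andP[/eqP an /eqP a0]; lia.
Qed.

(** * Removing a vertex that has one child in the binary tree *)

Definition skip p w : nat -> bool -> bool -> bool -> R :=
  fun q l m r => w (bump p q) l m r.

(* A vertex of status [(b, ~~ b)] is a node of the binary tree with exactly one
   child, the vertex preceding it in postorder; [z] is multiplied by the trees
   left when it is replaced by that child. *)
Lemma forest_sum_perturb b z p n w w' :
  (0 < p <= n)%N -> (forall q l m r, w q l m r = w q l m false) ->
  (forall q l m r,
     w' q l m r = w q l m r + z *+ [&& q == p, l == b & m == ~~ b]) ->
  forest_sum n.+1 w' = forest_sum n.+1 w + z * forest_sum n (skip p w).
Proof.
elim/ltn_ind: n p w w' => n IH p w w' /andP[p_gt0 p_le] w_flat w'E.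
have low a : (a <= p)%N -> forest_sum a w' = forest_sum a w.
  move=> a_le; apply: forest_sum_congr => q l m r q_lt _ _.
  by rewrite w'E (_ : (q == p) = false) ?addr0 //; lia.
have low_skip a : (a <= p)%N -> forest_sum a (skip p w) = forest_sum a w.
  move=> a_le; apply: forest_sum_congr => q l m r q_lt _ _.
  by rewrite /skip /bump leqNgt (leq_trans q_lt a_le).
case: (ltngtP p n) p_le => // [p_lt|pn] _; last first.
  subst n; rewrite !forest_sumS low_skip //.
  transitivity (\sum_(a < p.+1) (forest_sum a w * forest_sum (p - a) (inner a w)
      * w p (a == p :> nat) (a == 0 :> nat) true
    + z * (forest_sum a w * forest_sum (p - a) (inner a w) *+
       (((a == p :> nat) == b) && ((a == 0 :> nat) == ~~ b))))).
    apply: eq_bigr => a _; have a_le : (a <= p)%N by rewrite -ltnS.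
    rewrite low // w'E eqxx /=.
    rewrite (_ : forest_sum _ (inner a w') = forest_sum (p - a) (inner a w)).
      by rewrite mulrDr !mulrnAr [_ * z]mulrC.
    apply: forest_sum_congr => q l m r q_lt _ _.
    by rewrite /inner w'E (_ : (_ == p) = false) ?addr0 //; lia.
  rewrite big_split /= -mulr_sumr; congr (_ + z * _).
  case: b {w'E IH} => /=.
    rewrite big_ord_recr /= big1 => [|a _].
      by rewrite add0r eqxx subnn forest_sum0 mulr1 (gtn_eqF p_gt0).
    by rewrite (ltn_eqF (ltn_ord a)).
  rewrite big_ord_recl /= big1 => [|a _]; last by rewrite andbF.
  rewrite addr0 subn0 forest_sum0 mul1r (ltn_eqF p_gt0) /= mulr1n.
  (* The children of the removed vertex become children of the root, which [w_flat] makes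
     harmless. *)
  by apply: forest_sum_congr => q l m r _ _ _; rewrite /inner w_flat.
(* The removed vertex lies in the left factor for [a > p] ([X]), in the right one for [a < p]
   ([Y]). *)
pose X a := forest_sum a.-1 (skip p w) * forest_sum (n - a) (inner a w)
  * w n (a == n) false true.
pose Y a := forest_sum a w * forest_sum (n - a).-1 (inner a (skip p w))
  * w n false (a == 0)%N true.
transitivity (\sum_(a < n.+1) (forest_sum a w * forest_sum (n - a) (inner a w)
      * w n (a == n :> nat) (a == 0 :> nat) true
    + z * (X a *+ (p < a)%N + Y a *+ (a < p)%N))).
  rewrite forest_sumS; apply: eq_bigr => a _; have a_le : (a <= n)%N by rewrite -ltnS.
  rewrite w'E (_ : (n == p) = false) ?addr0; last by lia.
  case: (ltngtP a p) => [a_lt|a_gt|->].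
  - rewrite add0r low ?(ltnW a_lt) // /Y (_ : (a == n :> nat) = false); last by lia.
    have -> : (n - a = (n - a).-1.+1)%N by lia.
    rewrite (IH _ _ (p - a)%N (inner a w) (inner a w')); first last.
    + move=> q l m r; rewrite /inner w'E.
      by rewrite (_ : (_ == p)%N = (q == p - a)%N) //; lia.
    + by move=> q l m r; rewrite /inner.
    + by lia.
    + by lia.
    rewrite (_ : forest_sum _ (skip _ (inner a w)) =
      forest_sum (n - a).-1 (inner a (skip p w))).
      by rewrite /= mulr1n; set W := w _ _ _ _; ring.
    apply: forest_sum_congr => q l m r _ _ _; rewrite /skip /inner; congr w.
    by rewrite /bump; lia.
  - rewrite addr0 /X (_ : (a == 0 :> nat) = false); last by lia.
    rewrite (_ : forest_sum _ (inner a w') = forest_sum (n - a) (inner a w)).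
      have -> : (a = a.-1.+1 :> nat)%N by lia.
      rewrite (IH _ _ p w w') //; [|by lia|by lia].
      by rewrite /= mulr1n; set W := w _ _ _ _; ring.
    apply: forest_sum_congr => q l m r _ _ _; rewrite /inner w'E.
    by rewrite (_ : (_ == p) = false) ?addr0 //; lia.
  (* Position [p] is the first vertex of the right factor, a leftmost leaf, so the perturbation
     misses it. *)
  - rewrite addr0 mulr0 addr0 low //.
    rewrite (_ : forest_sum _ (inner p w') = forest_sum (n - p) (inner p w)) //.
    apply: forest_sum_congr => q l m r _ q0 _; rewrite /inner w'E.
    have [q_eq|_] := eqVneq (p + q)%N p; last by rewrite addr0.
    have /andP[-> ->] : l && m by apply: q0; lia.
    by case: b {IH w'E}; rewrite /= addr0.
rewrite [forest_sum n.+1 w]forest_sumS big_split /= -mulr_sumr; congr (_ + z * _).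
rewrite big_split /= big_ord_recl [X in _ + X]big_ord_recr /= mulr0n add0r.
rewrite [(n < p)%N]ltnNge (ltnW p_lt) mulr0n addr0 -big_split /=.
case: n {IH} p_lt @X @Y => // n p_lt X Y; rewrite forest_sumS.
have skip_last l m r : skip p w n l m r = w n.+1 l m r.
  by rewrite /skip (_ : bump p n = n.+1) // /bump; lia.
apply: eq_bigr => a _; have a_lt := ltn_ord a.
rewrite skip_last /X /Y (_ : bump 0 a = a.+1) // ltnS.
case: (ltnP a p) => [a_p|p_a].
  rewrite mulr0n add0r mulr1n low_skip ?(ltnW a_p) //.
  rewrite (_ : (n.+1 - a).-1 = n - a)%N; last by lia.
  by rewrite (_ : (a == n :> nat) = false) //; lia.
rewrite mulr0n addr0 mulr1n subSS eqSS (_ : (a == 0 :> nat) = false); last by lia.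
congr (_ * _ * _); apply: forest_sum_congr => q l m r _ _ _.
by rewrite /skip /inner (_ : bump p (a + q) = a.+1 + q)%N // /bump; lia.
Qed.
End TreeSums.

(** * Ballot numbers and forests with marked leaves *)

Section ClosedForms.
Variables (R : comNzRingType) (x z : R).

(* [ballot h N] is h / (2N + h) 'C(2N + h, N), the number of sequences of h
   binary trees with N nodes in total. *)
Definition ballot (h N : nat) : R :=
  if N is M.+1 then 'C(M.*2 + h.+1, M.+1)%:R - 'C(M.*2 + h.+1, M)%:R else 1.

Lemma ballotS h N : ballot h.+1 N.+1 = ballot h N.+1 + ballot h.+2 N.
Proof.
case: N => [|N] /=; first by rewrite !bin1 !bin0 -natr1; ring.
rewrite doubleS !addSn !addnS !binS !natrD; ring.
Qed.

Lemma ballot0S N : ballot 0 N.+1 = 0.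
Proof.
rewrite /= addn1 -[X in X - _]/('C(_, N.+1)%:R) -bin_sub; last first.
  by rewrite ltnS -addnn leq_addr.
by rewrite subSS -addnn addnK subrr.
Qed.

Lemma catalan_ballot N : (catalan N)%:R = ballot 1 N.
Proof.
case: N => [|N]; first by rewrite /catalan bin0.
have catE : (catalan N.+1 + 'C(N.*2.+2, N) = 'C(N.*2.+2, N.+1))%N.
  have := catalanE N.+1; rewrite doubleS => eq_cat.
  have := mul_bin_left N.*2.+2 N; rewrite (_ : N.*2.+2 - N = N.+2)%N; last by lia.
  by move: eq_cat; nia.
by rewrite /= addn2 -catE natrD addrK.
Qed.

(* Marked leaves, weighted by [z], fill k of the N + h empty slots of a sequence
   of h binary trees with N = n - k nodes. *)
Definition forest_gf (h n : nat) : R :=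
  \sum_(k < n.+1) ballot h (n - k) * 'C(n - k + h, k)%:R * z ^+ k * x ^+ (n - k).

Lemma forest_gf_h0 h : forest_gf h 0 = 1.
Proof. by rewrite /forest_gf big_ord1 /= bin0 !expr0 !mulr1. Qed.

Lemma forest_gf_0S n : forest_gf 0 n.+1 = 0.
Proof.
rewrite /forest_gf big_ord_recr /= subnn bin0n mulr0n mulr0 !mul0r addr0.
apply: big1 => k _; rewrite subSn; last by rewrite -ltnS.
by rewrite ballot0S !mul0r.
Qed.

(* The first tree of the sequence is empty, a single (marked) leaf, or a node
   whose two subtrees are put back in front of the sequence. *)
Lemma forest_gfS h n :
  forest_gf h.+1 n.+1 =
  forest_gf h n.+1 + z * forest_gf h n + x * forest_gf h.+2 n.
Proof.
rewrite /forest_gf !mulr_sumr.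
pose A k := if k is k'.+1
  then z * (ballot h (n - k') * 'C(n - k' + h, k')%:R * z ^+ k' * x ^+ (n - k'))
  else 0.
pose B k := if (k <= n)%N
  then x * (ballot h.+2 (n - k) * 'C(n - k + h.+2, k)%:R * z ^+ k * x ^+ (n - k))
  else 0.
rewrite [\sum_(k < n.+1) z * _](_ : _ = \sum_(k < n.+2) A k); last first.
  by rewrite [RHS]big_ord_recl /= add0r.
rewrite [\sum_(k < n.+1) x * _](_ : _ = \sum_(k < n.+2) B k); last first.
  rewrite [RHS]big_ord_recr /= {2}/B ltnn addr0; apply: eq_bigr => k _.
  by rewrite /B -ltnS ltn_ord.
rewrite -!big_split; apply: eq_bigr => -[k /= k_lt] _; rewrite /A /B {A B}.
have [k_le|n_lt] := leqP k n.
  rewrite subSn // ballotS; case: k k_lt k_le => [|k] _ k_lt.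
    by rewrite !bin0 subn0 !exprS; ring.
  rewrite (_ : n - k = (n - k.+1).+1)%N; last by lia.
  rewrite !addSn !addnS !binS !natrD !exprS; ring.
have -> : k = n.+1 by lia.
rewrite !subnn !add0n binS natrD exprS /=; ring.
Qed.

(** The generating function satisfies [P = 1 + z X + x X P^2], so the coefficients of its powers
    [P^h] obey the recurrence of [forest_gf]; truncation at degree [N] keeps [P] a polynomial. *)
Lemma forest_gf_unique (u : nat -> R) :
  u 0%N = 1 ->
  (forall n, u n.+1 = x * \sum_(a < n.+1) u a * u (n - a)%N + z *+ (n == 0)%N) ->
  forall n, u n = forest_gf 1 n.
Proof.
move=> u0 uS N; pose P := \poly_(i < N.+1) u i.
have P0 : P`_0 = 1 by rewrite coef_poly.
suffices PXE n h : (n <= N)%N -> (P ^+ h)`_n = forest_gf h n.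
  by rewrite -PXE // expr1 coef_poly ltnSn.
elim: n h => [|n IHn] h n_le.
  rewrite forest_gf_h0; elim: h => [|h IHh]; first by rewrite expr0 coef1.
  by rewrite exprS coef0M P0 mul1r.
elim: h => [|h IHh]; first by rewrite expr0 coef1 forest_gf_0S.
rewrite forest_gfS -IHh -!IHn ?(ltnW n_le) // exprS coefM big_ord_recl P0 mul1r.
rewrite subn0 -addrA; congr (_ + _).
have PS a : (a <= n)%N -> P`_a.+1 = x * (P * P)`_a + z *+ (a == 0)%N.
  move=> a_le; rewrite coef_poly ifT; last by lia.
  rewrite uS coefM; congr (x * _ + _); apply: eq_bigr => b _.
  by rewrite !coef_poly !ifT //; have := ltn_ord b; lia.
transitivity (\sum_(a < n.+1) (x * ((P * P)`_a * (P ^+ h)`_(n - a))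
    + (z *+ (a == 0 :> nat)) * (P ^+ h)`_(n - a))).
  by apply: eq_bigr => a _; rewrite PS -1?ltnS // mulrDl mulrA.
rewrite big_split -mulr_sumr -coefM -mulrA -!exprS addrC; congr (_ + _).
rewrite big_ord_recl /= subn0 mulr1n big1 ?addr0 // => a _.
by rewrite mul0r.
Qed.

(** * Pascal recurrences for the formula *)

(* The inner sum in the formula for $f_d$, with n = d - 1. *)
Definition choices (n i j k : nat) : nat :=
  \sum_(s < k.+1) 'C(j, s) * 'C(n + i + j - k - s, k - s).

Lemma choices0 n i j : choices n i j 0 = 1%N.
Proof. by rewrite /choices big_ord1 !bin0. Qed.

Lemma choices_addi n i j k : (k <= n)%N ->
  choices n.+1 i.+1 j k.+1 = (choices n.+1 i j k.+1 + choices n i j k)%N.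
Proof.
move=> k_le; rewrite /choices !(big_ord_recr k.+1) /= !subnn !bin0.
rewrite [RHS]addnAC -big_split /=; congr (_ + _)%N; apply: eq_bigr => s _.
(* For [s <= j] no subtraction is truncated; the other terms vanish. *)
have [s_j|/bin_small->] := leqP s j; last by rewrite !mul0n.
rewrite -mulnDr (_ : k.+1 - s = (k - s).+1)%N; last by have := ltn_ord s; lia.
rewrite (_ : n.+1 + i.+1 + j - k.+1 - s = (n + i + j - k - s).+1)%N; last by lia.
by rewrite (_ : n.+1 + i + j - k.+1 - s = n + i + j - k - s)%N ?binS //; lia.
Qed.

Lemma choices_addj n i j k : (k <= n)%N ->
  choices n.+1 i j.+1 k.+1 = (choices n.+1 i.+1 j k.+1 + choices n i j k)%N.
Proof.
move=> k_le; rewrite /choices !(big_ord_recl k.+1) !bin0 -[RHS]addnA.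
congr (_ + _)%N; first by congr (_ * 'C(_, _))%N; lia.
rewrite -big_split; apply: eq_bigr => s _; rewrite /= (_ : bump 0 s = s.+1) //.
rewrite binS mulnDl [(k.+1 - s.+1)%N]subSS; congr (_ * 'C(_, _) + _ * 'C(_, _))%N; lia.
Qed.

(** This is f_d divided by x, for n = d - 1, with 1 - x replaced by an independent [z]. *)
Definition fgf (n i j : nat) : R :=
  \sum_(k < n.+1) (catalan (n - k))%:R * z ^+ k * x ^+ (n - k) * (choices n i j k)%:R.

Lemma fgf_rec n i j i1 j1 i2 j2 :
  (forall k, (k <= n)%N ->
     choices n.+1 i j k.+1 = choices n.+1 i1 j1 k.+1 + choices n i2 j2 k)%N ->
  fgf n.+1 i j = fgf n.+1 i1 j1 + z * fgf n i2 j2.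
Proof.
move=> rec; rewrite /fgf !(big_ord_recl n.+1) !choices0 -addrA; congr (_ + _).
rewrite mulr_sumr -big_split; apply: eq_bigr => k _.
by rewrite /= (_ : bump 0 k = k.+1) // subSS rec -1?ltnS // natrD exprS; ring.
Qed.

Lemma fgf10 n : fgf n 1 0 = forest_gf 1 n.
Proof.
apply: eq_bigr => k _; rewrite (_ : choices n 1 0 k = 'C(n - k + 1, k)).
  by rewrite catalan_ballot; ring.
rewrite /choices big_ord_recl big1 => [|s _]; last by rewrite bin0n mul0n.
rewrite bin0 mul1n addn0 !subn0 addn0 addnBAC //.
by have := ltn_ord k; rewrite ltnS.
Qed.

End ClosedForms.

(** * Recurrences for the counted vertices *)

Section CountedVertices.
Variables (R : comNzRingType) (x z : R).

(* Vertices are numbered from 0 in postorder, and the root, which would get the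
   number n = d - 1, is left out; [l], [m], [r] tell whether the vertex is a
   leaf, is a leftmost child, is a child of the root. *)
Definition counted_status (n i j p : nat) (l m r : bool) : bool :=
  [|| [&& l, m & ~~ r],
      l && (m && r || ~~ m) && ((p < i) || (n <= p + j)) |
      ~~ l && m && (n <= p + j)]%N.

(** At [x = 'X] and [z = 1 - 'X] a counted vertex weighs 1, any other ['X]. *)
Definition counted_weight n i j p l m r : R :=
  x + z *+ counted_status n i j p l m r.

(** Being a child of the root matters only for a leftmost leaf, which is then the first vertex and
    is counted since [i >= 1]. *)
Lemma forest_sum_flat n i j : (0 < i)%N ->
  forest_sum n (counted_weight n i j) =
  forest_sum n (inner 0 (counted_weight n i j)).
Proof.
move=> i_gt0; apply: forest_sum_congr => p l m [] // p_lt _ p0.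
rewrite /inner /counted_weight /counted_status add0n.
case: l m p0 => [] [] //= p0; rewrite p0 //=.
by rewrite i_gt0.
Qed.

Lemma forest_sum_addi n i j : (0 < i)%N -> (i + j <= n)%N ->
  forest_sum n.+1 (inner 0 (counted_weight n.+1 i.+1 j)) =
  forest_sum n.+1 (inner 0 (counted_weight n.+1 i j)) +
  z * forest_sum n (inner 0 (counted_weight n i j)).
Proof.
move=> i_gt0 ij_le.
(* Only a non-leftmost leaf at position [i] is newly counted; by [i + j <= n] this position is below
   the upper range. *)
rewrite (@forest_sum_perturb _ true z i n (inner 0 (counted_weight n.+1 i j))) //.
- congr (_ + z * _); apply: forest_sum_congr => p l m r p_lt _ _.
  rewrite /skip /inner /counted_weight /counted_status !add0n /bump.
  rewrite (_ : (i <= p) + p < i = (p < i))%N; last by lia.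
  by rewrite (_ : (n.+1 <= (i <= p) + p + j) = (n <= p + j))%N //; lia.
- by lia.
- move=> p l m r; rewrite /inner /counted_weight /counted_status !add0n.
  case: l m => [] [] /=; rewrite ?andbF ?andbT ?orbF ?addr0 //.
  rewrite -addrA -mulrnDr; congr (_ + z *+ _); lia.
Qed.

Lemma forest_sum_addj n i j : (0 < i)%N -> (i + j <= n)%N ->
  forest_sum n.+1 (inner 0 (counted_weight n.+1 i j.+1)) =
  forest_sum n.+1 (inner 0 (counted_weight n.+1 i j)) +
  z * forest_sum n (inner 0 (counted_weight n i j)) *+ 2.
Proof.
move=> i_gt0 ij_le; set w := inner 0 (counted_weight n.+1 i j).
pose p := (n - j)%N; have p_rng : (0 < p <= n)%N by rewrite /p; lia.
(* Position [p] becomes counted for types (1) and (2); [w'] is the halfway weight with only type (2)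
   added. *)
pose w' q l m (r : bool) : R := w q l m r + z *+ [&& q == p, ~~ l & m].
have skip_w v : (forall q l m r, q != p -> v q l m r = w q l m r) ->
    forest_sum n (skip p v) = forest_sum n (inner 0 (counted_weight n i j)).
  move=> vw; apply: forest_sum_congr => q l m r q_lt _ _.
  rewrite /skip vw; last by rewrite /bump; lia.
  rewrite /w /inner /counted_weight /counted_status !add0n /bump.
  rewrite (_ : (p <= q) + q < i = (q < i))%N; last by rewrite /p; lia.
  by rewrite (_ : (n.+1 <= (p <= q) + q + j) = (n <= q + j))%N // /p; lia.
rewrite (@forest_sum_perturb _ true z p n w') //.
- rewrite (@forest_sum_perturb _ false z p n w) //.
    by rewrite !skip_w // => [|q l m r /negbTE qp]; rewrite ?mulr2n ?addrA // /w' qp addr0.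
  by move=> q l m r; rewrite /w'; case: l m => [] [].
- move=> q l m r; rewrite /w' /w /inner /counted_weight /counted_status !add0n.
  case: l m => [] [] /=; rewrite ?andbF ?andbT ?orbF ?addr0 //.
    rewrite -addrA -mulrnDr; congr (_ + z *+ _); rewrite /p; lia.
  rewrite -addrA -mulrnDr; congr (_ + z *+ _); rewrite /p; lia.
Qed.

Definition leaf_weight (p : nat) l m (r : bool) : R := x + z *+ (l && m).

Definition inner_leaf_weight (p : nat) l m r : R := x + z *+ [&& l, m & ~~ r].

(** The first vertex is a leftmost leaf, so the range below [i = 1] has no other leaf; for [j = 0]
    the upper range holds only the root. *)
Lemma forest_sum10 n :
  forest_sum n (inner 0 (counted_weight n 1 0)) = forest_sum n leaf_weight.
Proof.
apply: forest_sum_congr => p l m r p_lt p0 _.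
rewrite /inner /counted_weight /counted_status !add0n addn0.
rewrite (leqNgt n) p_lt andbF !orbF !andbT ltnS leqn0; congr (_ + z *+ _).
by case: eqP p0 => [-> /(_ erefl)/andP[-> ->]|_ _]; rewrite ?andbF ?orbF.
Qed.

Lemma forest_sum00 n :
  forest_sum n (counted_weight n 0 0) = forest_sum n inner_leaf_weight.
Proof.
apply: forest_sum_congr => p l m r p_lt _ _.
by rewrite /counted_weight /counted_status addn0 (leqNgt n) p_lt !andbF !orbF.
Qed.

Lemma forest_sum_leafS n :
  forest_sum n.+1 leaf_weight =
  x * (\sum_(a < n.+1) forest_sum a leaf_weight * forest_sum (n - a) leaf_weight)
  + z *+ (n == 0)%N.
Proof.
rewrite forest_sumS mulr_sumr.
under eq_bigr => a _ do rewrite mulrDr [_ * x]mulrC mulrnAr.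
rewrite big_split /=; congr (_ + _); rewrite big_ord_recl big1 => [|a _].
  by rewrite addr0 andbT eq_sym; case: n => [|n] //=; rewrite !forest_sum0 !mul1r.
by rewrite andbF.
Qed.

Lemma forest_sum_inner_leafS n :
  forest_sum n.+1 inner_leaf_weight =
  x * (\sum_(a < n.+1)
    forest_sum a inner_leaf_weight * forest_sum (n - a) leaf_weight).
Proof.
rewrite forest_sumS mulr_sumr; apply: eq_bigr => a _.
rewrite /inner_leaf_weight !andbF addr0 mulrC; congr (_ * (_ * _)).
apply: forest_sum_congr => p l m r _ _ _.
by rewrite /inner /leaf_weight andbT.
Qed.

(* The two weights differ only on trees whose first child of the root is a leaf;
   deleting that leaf keeps [inner_leaf_weight]. *)
Lemma forest_sum_first_leaf n :
  forest_sum n.+1 leaf_weight =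
  forest_sum n.+1 inner_leaf_weight + z * forest_sum n inner_leaf_weight.
Proof.
elim/ltn_ind: n => -[|n] IH; rewrite forest_sum_leafS forest_sum_inner_leafS.
  by rewrite !big_ord1 !forest_sum0 !mulr1.
rewrite mulr0n addr0 [in RHS]forest_sum_inner_leafS mulrCA -mulrDr; congr (x * _).
rewrite big_ord_recl [in RHS]big_ord_recl !forest_sum0 -addrA; congr (_ + _).
rewrite mulr_sumr -big_split; apply: eq_bigr => a _ /=.
by rewrite (_ : bump 0 a = a.+1) // subSS IH // mulrDl mulrA.
Qed.

Lemma forest_sum_leaf n : forest_sum n leaf_weight = fgf x z n 1 0.
Proof.
rewrite fgf10; move: n.
apply: (@forest_gf_unique _ x z (fun k => forest_sum k leaf_weight)).
  exact: forest_sum0.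
exact: forest_sum_leafS.
Qed.

Lemma fgf0 i j : fgf x z 0 i j = 1.
Proof. by rewrite /fgf big_ord1 choices0 !mulr1 /catalan bin0. Qed.

Lemma forest_sum_counted00 n :
  forest_sum n (counted_weight n 0 0) = fgf x z n 0 0.
Proof.
rewrite forest_sum00; elim: n => [|n IHn]; first by rewrite forest_sum0 fgf0.
(* Adding this term to both sides turns the claim into the case (1, 0). *)
apply: (@addIr _ (z * forest_sum n inner_leaf_weight)).
rewrite -forest_sum_first_leaf forest_sum_leaf IHn.
by apply: fgf_rec => k; exact: choices_addi.
Qed.

Lemma forest_sum_counted n i j : (0 < i)%N -> (i + j <= n)%N ->
  forest_sum n (counted_weight n i j) = fgf x z n i j.
Proof.
move=> i_gt0; rewrite forest_sum_flat //.
elim: j n => [|j IHj] n ij_le.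
  case: i i_gt0 ij_le => // i _; elim: i n => [|i IHi] n ij_le.
    by rewrite forest_sum10 forest_sum_leaf.
  case: n ij_le => // n ij_le; rewrite forest_sum_addi ?IHi //; [|lia..].
  by apply/esym/fgf_rec => k; exact: choices_addi.
case: n ij_le => [|n] ij_le; first by move: ij_le i_gt0; lia.
rewrite forest_sum_addj ?IHj //; [|lia..].
(* Going from [(i, j)] through [(i.+1, j)] to [(i, j.+1)] produces the term twice. *)
rewrite (@fgf_rec _ _ _ n i j.+1 i.+1 j i j); last by move=> k; exact: choices_addj.
rewrite (@fgf_rec _ _ _ n i.+1 j i j i j); last by move=> k; exact: choices_addi.
by rewrite mulr2n addrA.
Qed.

End CountedVertices.

(** * From weights to coefficients *)

Lemma prod_indicatorX (I : Type) (P : pred I) (s : seq I) :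
  \prod_(v <- s) ('X + (1 - 'X) *+ P v) = 'X^(size s - count P s) :> {poly int}.
Proof.
elim: s => [|v s IHs]; first by rewrite big_nil.
rewrite big_cons IHs /=; have := count_size P s; case: (P v) => /= le_s.
  by rewrite addrC subrK mul1r.
by rewrite add0n addr0 subSn // exprS.
Qed.

(** The extra factor ['X] belongs to the root, never counted: it is not leftmost, nor a leaf as
    [n > 0]. *)
Lemma weight_counted n i j (t : ptree) : (0 < n)%N -> nvertices t = n.+1 ->
  'X * weight (counted_weight 'X (1 - 'X) n i j) t =
  'X^(n.+1 - ncounted n.+1 i j t) :> {poly int} /\ (ncounted n.+1 i j t <= n)%N.
Proof.
move=> n_gt0 tn; have szE : size (descendants t) = n by rewrite size_descendants tn.
have not_root : counted n.+1 i j t [::] = false.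
  rewrite /counted /special0 /special1 /special2 /leftmost /= !andbF !orbF andbT.
  rewrite /leaf /subtree /=; case: t tn {szE} => -[|u us] //= [n0].
  by rewrite -n0 in n_gt0.
have ncE : ncounted n.+1 i j t = count (counted n.+1 i j t) (descendants t).
  by rewrite /ncounted postorderE -cats1 count_cat /= not_root !addn0.
have nc_le : (ncounted n.+1 i j t <= n)%N by rewrite ncE -szE count_size.
split=> //; rewrite subSn // exprS; congr ('X * _).
rewrite ncE -{2}szE -prod_indicatorX (big_nth [::]) big_mkord /weight.
apply: eq_bigr => p _; have p_lt : (p < n)%N by rewrite -[n]szE.
set v := nth _ _ _; rewrite /counted_weight; congr (_ + _ *+ _).
have labelE : label t v = p.+1.
  congr _.+1; rewrite (_ : v = nth [::] (postorder t) p).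
    by rewrite index_uniq ?postorder_uniq // size_postorder tn ltnW.
  by rewrite postorderE nth_rcons ltn_ord.
rewrite /counted_status /counted /special0 /special1 /special2 labelE.
by rewrite leq_subLR addnS ltnS [(j + p)%N]addnC.
Qed.

Lemma fpolyE n i j : fpoly n.+1 i j = 'X * fgf 'X (1 - 'X) n i j.
Proof.
rewrite /fpoly big_mkord /fgf mulr_sumr; apply: eq_bigr => k _.
have k_le : (k <= n)%N by rewrite -ltnS.
rewrite subn1 /= subSn // exprS (_ : choices n i j k =
  (\sum_(0 <= s < j.+1 | s <= k) 'C(j, s) * 'C(n.+1 + i + j - 1 - k - s, k - s))%N).
  by ring.
rewrite /choices -(big_mkord xpredT (fun s => 'C(j, s) * 'C(n + i + j - k - s, k - s))%N).
(* Both sums are extended to a common range; terms with [s > j] vanish. *)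
rewrite [LHS](big_nat_widen _ _ (j.+1 + k.+1)) ?leq_addl //.
rewrite [RHS](big_nat_widen _ _ (j.+1 + k.+1)) ?leq_addr //.
rewrite [RHS]big_mkcond [LHS]big_mkcond; apply: eq_bigr => s _ /=.
have [s_j|j_s] := leqP s j; last by rewrite bin_small // mul0n !if_same.
rewrite !ltnS ?s_j ?andbT.
by rewrite (_ : n.+1 + i + j - 1 = n + i + j)%N //; lia.
Qed.

Theorem theorem3p12 (d i j : nat) (hd : (2 <= d)%N) (hj : (j < d - 1)%N)
    (hij : (i = 0%N /\ j = 0%N) \/ ((1 <= i)%N /\ (i + j <= d - 1)%N))
    (m : int) :
  coefz (fpoly d i j) (d%:Z - m) =
  #|[set T : plane_tree d | (ncounted d i j T)%:Z == m]|%:Z.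
Proof.
case: d hd hj hij => // n n_gt0; rewrite subn1 /= => j_lt hij.
have [wE nc_le] : (forall T : plane_tree n.+1,
    'X * weight (counted_weight 'X (1 - 'X) n i j) T =
      'X^(n.+1 - ncounted n.+1 i j T) :> {poly int})
  /\ (forall T : plane_tree n.+1, (ncounted n.+1 i j T <= n)%N).
  by split=> T; have [] := weight_counted i j n_gt0 (eqP (pt_valP T)).
have -> : fpoly n.+1 i j = \sum_(T : plane_tree n.+1) 'X^(n.+1 - ncounted n.+1 i j T).
  rewrite fpolyE; transitivity
    ('X * forest_sum n (counted_weight 'X (1 - 'X) n i j) : {poly int}).
    congr (_ * _); case: hij => [[-> ->]|[i_gt0 ij_le]].
      by rewrite forest_sum_counted00.
    by rewrite forest_sum_counted.
  by rewrite mulr_sumr; apply: eq_bigr => T _; exact: wE.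
case E : (n.+1%:Z - m) => [e|e] /=; last first.
  (* A negative exponent means [m > n + 1], above every count. *)
  apply/esym/eqP; rewrite eqz_nat cards_eq0; apply/eqP/setP => T.
  by rewrite !inE; apply/eqP => m_eq; have := nc_le T; lia.
rewrite coef_sum -natz -sum1_card natr_sum [RHS]big_mkcond; apply: eq_bigr => T _.
rewrite coefXn inE (_ : (e == _)%N = ((ncounted n.+1 i j T)%:Z == m)).
  by case: eqP.
by have := nc_le T; lia.
Qed.
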